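(* Let $F=(F_1,\dots,F_m):\mathbb{R}^n\to\mathbb{R}^m$ be continuously differentiable. Assume that, for each $i\in[m]$, $\nabla F_i$ is Lipschitz continuous with constant $L_i$ and $F_i$ is strongly convex with modulus $\mu_i$, and let $\sigma\le\frac12$ in the line search. Then the stepsize $\beta^k$ generated by the Barzilai-Borwein descent method (BBDMO) with either monotone (Armijo) or nonmonotone (max-type or average-type) line search satisfies $$\min\{1,\beta_{\min}\}\le\beta^k\le1,\qquad\text{where}\quad \beta_{\min}:=\min\left\{\frac{2\gamma(1-\sigma)\mu_i}{L_i}:i\in[m]\right\}.$$
   Context: Notation: $[m]=\{1,\dots,m\}$; $\Delta_m=\{\lambda\in\mathbb{R}^m:\sum_{i\in[m]}\lambda_i=1,\ \lambda_i\ge 0\}$; $JF(x)\in\mathbb{R}^{m\times n}$ is the Jacobian; inequalities between vectors are componentwise; $\|\cdot\|$ is the Euclidean norm. A differentiable $f$ is strongly convex with modulus $\mu>0$ if $f(y)\ge f(x)+\langle\nabla f(x),y-x\rangle+\frac{\mu}{2}\|y-x\|^2$ for all $x,y$. Line searches. Fix $\sigma,\gamma\in(0,1)$. Given $x^k$, a direction $d^k$ and a reference vector $C^k\in\mathbb{R}^m$, the stepsize $\beta^k$ is the largest element $\beta$ of $\{1,\gamma,\gamma^2,\dots\}$ such that $$F(x^k+\beta d^k)-C^k\le \sigma\beta\, JF(x^k)d^k .$$ - Armijo (monotone): $C^k=F(x^k)$. - Max-type nonmonotone: $C^k_i=\max_{0\le j\le\min(k,M)}F_i(x^{k-j})$ for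 $i\in[m]$, with a fixed nonnegative integer $M$. - Average-type nonmonotone: with fixed $\eta\in(0,1)$, $q^0=1$, $C^0=F(x^0)$, and for $k\ge1$: $q^k=\eta q^{k-1}+1$, $C^k=\frac{\eta q^{k-1}}{q^k}C^{k-1}+\frac{1}{q^k}F(x^k)$. BBDMO. Fix a starting point $x^0\in\mathbb{R}^n$, a small positive constant $\alpha_{\min}$ and a large positive constant $\alpha_{\max}$. - For $k=0$, a steepest descent iteration is done: let $d^0=-\sum_{i\in[m]}\lambda_i^0\nabla F_i(x^0)$, where $\lambda^0\in\arg\min_{\lambda\in\Delta_m}\frac12\|\sum_{i\in[m]}\lambda_i\nabla F_i(x^0)\|^2$; if $d^0=0$ stop, otherwise let $\beta^0$ be the Armijo stepsize along $d^0$ and set $x^1=x^0+\beta^0d^0$. - For $k\ge1$: put $s^{k-1}=x^k-x^{k-1}$, $y_i^{k-1}=\nabla F_i(x^k)-\nabla F_i(x^{k-1})$, and for each $i\in[m]$ $$\alpha_i^k=\begin{cases}\max\left\{\alpha_{\min},\min\left\{\frac{\langle s^{k-1},y_i^{k-1}\rangle}{\langle s^{k-1},s^{k-1}\rangle},\alpha_{\max}\right\}\right\}, & \langle s^{k-1},y_i^{k-1}\rangle>0,\\[4pt] \max\left\{\alpha_{\min},\min\left\{\frac{\|y_i^{k-1}\|}{\|s^{k-1}\|},\alpha_{\max}\right\}\right\}, & \langle s^{k-1},y_i^{k-1}\rangle<0,\\[4pt] \alpha_{\min}, & \langle s^{k-1},y_i^{k-1}\rangle=0.\end{cases}$$ Let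 $\lambda^k\in\arg\min_{\lambda\in\Delta_m}\frac12\left\|\sum_{i\in[m]}\lambda_i\frac{1}{\alpha_i^k}\nabla F_i(x^k)\right\|^2$ and $d^k_{BB}=-\sum_{i\in[m]}\lambda_i^k\frac{1}{\alpha_i^k}\nabla F_i(x^k)$ (equivalently, $d^k_{BB}$ is the unique minimizer over $d\in\mathbb{R}^n$ of $\max_{i\in[m]}\langle\frac{1}{\alpha_i^k}\nabla F_i(x^k),d\rangle+\frac12\|d\|^2$). If $d^k_{BB}=0$ the method stops; otherwise $\beta^k$ is the stepsize given by the chosen line search along $d^k_{BB}$ and $x^{k+1}=x^k+\beta^kd^k_{BB}$.
   Formalization: The lower bound is stated only for k ≥ 1 (it fails for the initial steepest descent step, e.g. F = (L/2)x² with L large), and ''large'' α_max is made precise as α_max ≥ μ_i for all i (the bound fails for α_max much smaller than μ_i). *)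

(* Defs.v *)
From mathcomp Require Import all_boot all_order all_algebra.
From mathcomp Require Import all_classical all_reals all_analysis.

Set Implicit Arguments.
Unset Strict Implicit.
Unset Printing Implicit Defensive.

Import Order.TTheory GRing.Theory Num.Theory.
Import numFieldNormedType.Exports.
Local Open Scope classical_set_scope.
Local Open Scope ring_scope.

(* Points of R^n are row vectors.  The library norm on 'rV[R]_n is the sup
   norm, hence the Euclidean one below.  The library Jacobian ['J F x] acts on
   row vectors from the right, so it is the transpose of the usual JF(x): the
   product JF(x) d is [d *m 'J F x], and the gradient of F_i is its i-th
   column. *)

Definition dot (R : realType) (n : nat) (u v : 'rV[R]_n) : R :=
  \sum_(j < n) u 0 j * v 0 j.

Definition enorm (R : realType) (n : nat) (u : 'rV[R]_n) : R :=
  Num.sqrt (dot u u).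

Definition grad (R : realType) (n m : nat) (F : 'rV[R]_n -> 'rV[R]_m)
    (i : 'I_m) (x : 'rV[R]_n) : 'rV[R]_n :=
  (col i ('J F x))^T.

Definition continuously_differentiable (R : realType) (n m : nat)
    (F : 'rV[R]_n -> 'rV[R]_m) : Prop :=
  (forall x, differentiable F x) /\ continuous (fun x => 'J F x).

Definition lipschitz_gradient (R : realType) (n m : nat)
    (F : 'rV[R]_n -> 'rV[R]_m) (i : 'I_m) (L : R) : Prop :=
  forall x y, enorm (grad F i y - grad F i x) <= L * enorm (y - x).

Definition strongly_convex (R : realType) (n m : nat)
    (F : 'rV[R]_n -> 'rV[R]_m) (i : 'I_m) (mu : R) : Prop :=
  0 < mu /\
  forall x y, F x 0 i + dot (grad F i x) (y - x)
                + mu / 2 * enorm (y - x) ^+ 2 <= F y 0 i.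

Definition simplex (R : realType) (m : nat) : set 'rV[R]_m :=
  [set lam | \sum_(i < m) lam 0 i = 1 /\ forall i, 0 <= lam 0 i].

Definition combination (R : realType) (n m : nat) (v : 'I_m -> 'rV[R]_n)
    (lam : 'rV[R]_m) : 'rV[R]_n :=
  \sum_(i < m) lam 0 i *: v i.

Definition min_norm_weights (R : realType) (n m : nat)
    (v : 'I_m -> 'rV[R]_n) : set 'rV[R]_m :=
  [set lam | simplex lam /\
     forall lam', simplex lam' ->
       2^-1 * enorm (combination v lam) ^+ 2
         <= 2^-1 * enorm (combination v lam') ^+ 2].

Definition bb_alpha (R : realType) (n : nat) (alpha_min alpha_max : R)
    (s y : 'rV[R]_n) : R :=
  if 0 < dot s y then
    Num.max alpha_min (Num.min (dot s y / dot s s) alpha_max)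
  else if dot s y < 0 then
    Num.max alpha_min (Num.min (enorm y / enorm s) alpha_max)
  else alpha_min.

(* The vectors combined at iteration k: the plain gradients at k = 0, and the
   gradients divided by the Barzilai-Borwein parameters at k >= 1. *)
Definition scaled_grad (R : realType) (n m : nat) (F : 'rV[R]_n -> 'rV[R]_m)
    (alpha_min alpha_max : R) (x : nat -> 'rV[R]_n) (k : nat) (i : 'I_m) :
    'rV[R]_n :=
  if k is k'.+1 then
    (bb_alpha alpha_min alpha_max (x k - x k')
       (grad F i (x k) - grad F i (x k')))^-1 *: grad F i (x k)
  else grad F i (x 0%N).

Definition direction (R : realType) (n m : nat) (F : 'rV[R]_n -> 'rV[R]_m)
    (alpha_min alpha_max : R) (x : nat -> 'rV[R]_n) (lam : nat -> 'rV[R]_m)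
    (k : nat) : 'rV[R]_n :=
  - combination (scaled_grad F alpha_min alpha_max x k) (lam k).

Inductive line_search (R : realType) : Type :=
| Armijo
| MaxType of nat
| AverageType of R.
Arguments Armijo {R}.
Arguments MaxType {R}.

Definition valid_line_search (R : realType) (ls : line_search R) : Prop :=
  if ls is AverageType eta then 0 < eta < 1 else True.

Fixpoint avg_q (R : realType) (eta : R) (k : nat) : R :=
  if k is k'.+1 then eta * avg_q eta k' + 1 else 1.

Fixpoint avg_C (R : realType) (n m : nat) (F : 'rV[R]_n -> 'rV[R]_m)
    (eta : R) (x : nat -> 'rV[R]_n) (k : nat) : 'rV[R]_m :=
  if k is k'.+1 then
    (eta * avg_q eta k' / avg_q eta k) *: avg_C F eta x k'
      + (avg_q eta k)^-1 *: F (x k)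
  else F (x 0%N).

Definition max_C (R : realType) (n m : nat) (F : 'rV[R]_n -> 'rV[R]_m)
    (M : nat) (x : nat -> 'rV[R]_n) (k : nat) : 'rV[R]_m :=
  \row_i \big[Num.max/F (x k) 0 i]_(j < (minn k M).+1) F (x (k - j)%N) 0 i.

(* Iteration 0 uses the Armijo rule whichever line search is chosen. *)
Definition reference (R : realType) (n m : nat) (F : 'rV[R]_n -> 'rV[R]_m)
    (ls : line_search R) (x : nat -> 'rV[R]_n) (k : nat) : 'rV[R]_m :=
  if k is 0%N then F (x 0%N) else
  match ls with
  | Armijo => F (x k)
  | MaxType M => max_C F M x k
  | AverageType eta => avg_C F eta x k
  end.

Definition acceptable (R : realType) (n m : nat) (F : 'rV[R]_n -> 'rV[R]_m)
    (sigma gamma : R) (C : 'rV[R]_m) (x d : 'rV[R]_n) : set R :=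
  [set b | (exists j : nat, b = gamma ^+ j) /\
     forall i, (F (x + b *: d) - C) 0 i <= ((sigma * b) *: (d *m 'J F x)) 0 i].

Definition is_stepsize (R : realType) (n m : nat) (F : 'rV[R]_n -> 'rV[R]_m)
    (sigma gamma : R) (C : 'rV[R]_m) (x d : 'rV[R]_n) (b : R) : Prop :=
  acceptable F sigma gamma C x d b /\
  forall b', acceptable F sigma gamma C x d b' -> b' <= b.

(* Iteration k takes place, without the method stopping, and produces the
   stepsize [beta k] and the iterate [x k.+1]. *)
Definition bbdmo_step (R : realType) (n m : nat) (F : 'rV[R]_n -> 'rV[R]_m)
    (sigma gamma alpha_min alpha_max : R) (ls : line_search R)
    (x : nat -> 'rV[R]_n) (lam : nat -> 'rV[R]_m) (beta : nat -> R)
    (k : nat) : Prop :=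
  let d := direction F alpha_min alpha_max x lam k in
  [/\ min_norm_weights (scaled_grad F alpha_min alpha_max x k) (lam k),
      d != 0,
      is_stepsize F sigma gamma (reference F ls x k) (x k) d (beta k)
    & x k.+1 = x k + beta k *: d].

(* The first k.+1 iterations take place from the starting point [x0].  Values
   of the sequences beyond them are irrelevant, so finite runs are covered. *)
Definition bbdmo_run (R : realType) (n m : nat) (F : 'rV[R]_n -> 'rV[R]_m)
    (sigma gamma alpha_min alpha_max : R) (ls : line_search R)
    (x0 : 'rV[R]_n) (x : nat -> 'rV[R]_n) (lam : nat -> 'rV[R]_m)
    (beta : nat -> R) (k : nat) : Prop :=
  x 0%N = x0 /\
  forall j, (j <= k)%N ->
    bbdmo_step F sigma gamma alpha_min alpha_max ls x lam beta j.

Definition beta_min (R : realType) (m : nat) (sigma gamma : R)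
    (mu L : 'I_m.+1 -> R) : R :=
  let b i := 2 * gamma * (1 - sigma) * mu i / L i in
  \big[Num.min/b ord0]_(i < m.+1) b i.

(* Main.v *)
(* Strong convexity makes the Barzilai-Borwein parameter of F_i at least mu_i,
   and optimality of the weights gives <grad F_i, d> <= - alpha_i |d|^2.  Hence
   <grad F_i(x^k), d> <= - mu_i |d|^2.  When beta^k < 1, the trial step
   b = beta^k / gamma was rejected for some i; since every reference vector
   dominates F(x^k), the descent lemma turns this rejection into
   b > 2 (1 - sigma) mu_i / L_i. *)

Require Import Defs.
From mathcomp Require Import all_boot all_order all_algebra.
From mathcomp Require Import all_classical all_reals all_analysis.
From mathcomp Require Import ring lra.

Set Implicit Arguments.
Unset Strict Implicit.
Unset Printing Implicit Defensive.

Import Order.TTheory GRing.Theory Num.Theory.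
Import numFieldNormedType.Exports.
Local Open Scope classical_set_scope.
Local Open Scope ring_scope.

(** * Euclidean inner product and norm, up to the Cauchy-Schwarz inequality *)

Section EuclideanSpace.
Variables (R : realType) (n : nat).
Implicit Types (u v w : 'rV[R]_n) (a : R).

Lemma dotC u v : dot u v = dot v u.
Proof. by apply: eq_bigr => j _; rewrite mulrC. Qed.

Lemma dotDl u v w : dot (u + v) w = dot u w + dot v w.
Proof. by rewrite -big_split; apply: eq_bigr => j _; rewrite mxE mulrDl. Qed.

Lemma dotZl a u v : dot (a *: u) v = a * dot u v.
Proof. by rewrite /dot mulr_sumr; apply: eq_bigr => j _; rewrite mxE mulrA. Qed.

Lemma dotNl u v : dot (- u) v = - dot u v.
Proof. by rewrite -scaleN1r dotZl mulN1r. Qed.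

Lemma dotDr u v w : dot w (u + v) = dot w u + dot w v.
Proof. by rewrite !(dotC w) dotDl. Qed.

Lemma dotZr a u v : dot v (a *: u) = a * dot v u.
Proof. by rewrite !(dotC v) dotZl. Qed.

Lemma dotNr u v : dot v (- u) = - dot v u.
Proof. by rewrite !(dotC v) dotNl. Qed.

Definition dotE := (dotDl, dotDr, dotNl, dotNr, dotZl, dotZr).

Lemma dot_ge0 u : 0 <= dot u u.
Proof. by apply: sumr_ge0 => j _; rewrite -expr2 sqr_ge0. Qed.

Lemma dot_gt0 u : u != 0 -> 0 < dot u u.
Proof.
move=> u0; rewrite lt_neqAle dot_ge0 andbT eq_sym.
apply: contra u0 => /eqP uu0; apply/eqP/rowP => j; rewrite mxE.
have /psumr_eq0P uj0 : forall i, true -> 0 <= u 0 i * u 0 i.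
  by move=> i _; rewrite -expr2 sqr_ge0.
by apply/eqP; rewrite -sqrf_eq0 expr2; apply/eqP/uj0.
Qed.

Lemma enorm_ge0 u : 0 <= enorm u.
Proof. exact: sqrtr_ge0. Qed.

Lemma sqr_enorm u : enorm u ^+ 2 = dot u u.
Proof. by rewrite sqr_sqrtr ?dot_ge0. Qed.

Lemma enormZ a u : 0 <= a -> enorm (a *: u) = a * enorm u.
Proof.
move=> a0; rewrite /enorm !dotE mulrA -expr2 sqrtrM ?sqr_ge0 //.
by rewrite sqrtr_sqr ger0_norm.
Qed.

Lemma dot_le_enormM u v : dot u v <= enorm u * enorm v.
Proof.
have [->|u0] := eqVneq u 0.
  rewrite -[X in dot X](scale0r (0 : 'rV[R]_n)) dotZl mul0r.
  by rewrite mulr_ge0 ?enorm_ge0.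
have [->|v0] := eqVneq v 0.
  rewrite -[X in dot _ X](scale0r (0 : 'rV[R]_n)) dotZr mul0r.
  by rewrite mulr_ge0 ?enorm_ge0.
have au : 0 < enorm u by rewrite sqrtr_gt0 dot_gt0.
have av : 0 < enorm v by rewrite sqrtr_gt0 dot_gt0.
(* With $a=\|u\|$ and $b=\|v\|$, $\|bu-av\|^2=2ab(ab-\langle u,v\rangle)$; the zero vectors were set
   aside so that $ab$ can be cancelled. *)
have := dot_ge0 (enorm v *: u - enorm u *: v).
rewrite !dotE (dotC v u) -!sqr_enorm => H.
rewrite -(ler_pM2l (mulr_gt0 au av)); lra.
Qed.

End EuclideanSpace.

(** * Passage to the limit and the descent lemma *)

(** An Archimedean substitute for a limit. It removes the error of a Riemann sum in the descent
    lemma and the second-order term in the optimality condition for the weights. *)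
Lemma ler_add_harmonic (R : archiRealFieldType) (a b c : R) :
  (forall N : nat, a <= b + c / N.+1%:R) -> a <= b.
Proof.
move=> H; apply/ler_addgt0Pr => e e0.
apply: le_trans (H (Num.bound `|c / e|)) _.
rewrite lerD2l ler_pdivrMr ?ltr0n // mulrC -ler_pdivrMr //.
apply: le_trans (ler_norm _) _; apply: ltW.
apply: lt_le_trans (archi_boundP (normr_ge0 _)) _.
by rewrite ler_nat leqnSn.
Qed.

(* Convexity bounds the increment over each of N equal subintervals by the
   gradient at its right end, so a Riemann sum replaces the integral. *)
Lemma descent_lemma (R : realType) (n : nat) (f : 'rV[R]_n -> R)
    (g : 'rV[R]_n -> 'rV[R]_n) (L : R) (x d : 'rV[R]_n) :
    (forall y z, f y + dot (g y) (z - y) <= f z) ->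
    (forall y z, enorm (g z - g y) <= L * enorm (z - y)) ->
  f (x + d) <= f x + dot (g x) d + L / 2 * dot d d.
Proof.
move=> fcvx glip; apply: (@ler_add_harmonic _ _ _ (L / 2 * dot d d)) => N.
have N0 : N.+1%:R != 0 :> R by rewrite pnatr_eq0.
set h := N.+1%:R^-1 : R; have h0 : 0 <= h by rewrite invr_ge0 ler0n.
have step (t : R) : 0 <= t ->
    dot (g (x + t *: d)) d <= dot (g x) d + L * t * dot d d.
  move=> t0; have : dot (g (x + t *: d) - g x) d <= L * t * dot d d.
    apply: le_trans (dot_le_enormM _ _) _.
    rewrite -sqr_enorm expr2 mulrA ler_wpM2r ?enorm_ge0 //.
    apply: le_trans (glip _ _) _.
    by rewrite addrAC subrr add0r enormZ // mulrA.
  by rewrite !dotE; lra.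
(* The last factor is twice the sum of [i * h ^+ 2] for [i] from 1 to [j]. At [j = N.+1] it equals
   [1 + h], and the excess [h] gives the error term announced above. *)
have bound j : f (x + (j%:R * h) *: d) <=
    f x + j%:R * h * dot (g x) d +
    L / 2 * dot d d * (j%:R * (j%:R + 1) * h ^+ 2).
  elim: j => [|j IHj]; first by rewrite !mul0r scale0r !addr0 mulr0 addr0.
  have := fcvx (x + (j.+1%:R * h) *: d) (x + (j%:R * h) *: d).
  have -> : x + (j%:R * h) *: d - (x + (j.+1%:R * h) *: d) = - h *: d.
    by rewrite opprD addrACA subrr add0r -scalerBl -[j.+1%:R]natr1;
      congr (_ *: _); ring.
  have := step (j.+1%:R * h) (mulr_ge0 (ler0n _ _) h0).
  move/(ler_wpM2l h0); rewrite !dotE; move: IHj; rewrite -[j.+1%:R]natr1; lra.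
have := bound N.+1; rewrite mulfV // scale1r => /le_trans; apply.
rewrite le_eqVlt; apply/orP; left; apply/eqP; rewrite /h; field.
by rewrite nat1r.
Qed.

(** * First-order optimality of the minimum-norm weights *)

Lemma combination_linear (R : realType) (n m : nat) (v : 'I_m -> 'rV[R]_n)
    (a b : R) (l l' : 'rV[R]_m) :
  combination v (a *: l + b *: l') =
  a *: combination v l + b *: combination v l'.
Proof.
rewrite /combination !scaler_sumr -big_split; apply: eq_bigr => i _.
by rewrite !mxE scalerDl !scalerA.
Qed.

Lemma combination_delta (R : realType) (n m : nat) (v : 'I_m -> 'rV[R]_n)
    (i : 'I_m) :
  combination v (delta_mx 0 i) = v i.
Proof.
rewrite /combination (bigD1 i) //= big1 => [|j ji].
  by rewrite addr0 mxE !eqxx scale1r.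
by rewrite mxE (negbTE ji) scale0r.
Qed.

Lemma simplex_convex (R : realType) (m : nat) (l l' : 'rV[R]_m) (t : R) :
  0 <= t <= 1 -> simplex l -> simplex l' ->
  simplex ((1 - t) *: l + t *: l').
Proof.
move=> /andP[t0 t1] [sl l0] [sl' l0']; split=> [|i].
  under eq_bigr do rewrite !mxE.
  by rewrite big_split /= -!mulr_sumr sl sl'; ring.
by rewrite !mxE addr_ge0 // mulr_ge0 // subr_ge0.
Qed.

Lemma simplex_delta (R : realType) (m : nat) (i : 'I_m) :
  simplex (delta_mx 0 i : 'rV[R]_m).
Proof.
split=> [|j]; last by rewrite mxE ler0n.
rewrite (bigD1 i) //= big1 => [|j ji]; first by rewrite addr0 mxE !eqxx.
by rewrite mxE (negbTE ji).
Qed.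

(** Moving the weights a fraction $t$ towards vertex $i$ changes the combination $w$ into $w+tz$
    with $z=v_i-w$. Minimality gives $0\le 2t\langle z,w\rangle+t^2\|z\|^2$; divide by $2t$ and let
    $t=1/(N+1)$ tend to 0. *)
Lemma min_norm_weights_dot (R : realType) (n m : nat) (v : 'I_m -> 'rV[R]_n)
    (l : 'rV[R]_m) (i : 'I_m) :
  min_norm_weights v l ->
  dot (combination v l) (combination v l) <= dot (v i) (combination v l).
Proof.
move=> [sl lmin]; set w := combination v l.
rewrite -subr_ge0 -dotNl -dotDl; set z := v i - w.
apply: (@ler_add_harmonic _ _ _ (dot z z / 2)) => N.
have t01 : 0 < (N.+1%:R : R)^-1 <= 1.
  by rewrite invr_gt0 ltr0n invf_le1 ?ltr0n ?ler1n.
move: t01; set t := _^-1 => /andP[t0 t1].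
have := lmin _ (simplex_convex (t := t) _ sl (simplex_delta _ i)).
rewrite combination_linear combination_delta -/w (ltW t0) t1 => /(_ isT).
have -> : (1 - t) *: w + t *: v i = w + t *: z.
  by rewrite scalerBl scale1r scalerBr -addrA [- _ + _]addrC.
clearbody z w; rewrite !sqr_enorm !dotE (dotC w z) => H.
rewrite -(pmulr_rge0 _ t0); lra.
Qed.

(** * Directional derivatives and consequences of strong convexity *)

Lemma mul_jacobian (R : realType) (n m : nat) (F : 'rV[R]_n -> 'rV[R]_m)
    (x d : 'rV[R]_n) (i : 'I_m) :
  (d *m 'J F x) 0 i = dot (grad F i x) d.
Proof. by rewrite dotC mxE; apply: eq_bigr => j _; rewrite /grad !mxE. Qed.

Lemma sufficient_decreaseE (R : realType) (n m : nat)
    (F : 'rV[R]_n -> 'rV[R]_m) (C : 'rV[R]_m) (x y d : 'rV[R]_n) (a : R)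
    (i : 'I_m) :
  ((F y - C) 0 i <= (a *: (d *m 'J F x)) 0 i) =
  (F y 0 i - C 0 i <= a * dot (grad F i x) d).
Proof.
rewrite -mul_jacobian; have -> : (F y - C) 0 i = F y 0 i - C 0 i by rewrite !mxE.
by rewrite [in LHS]mxE.
Qed.

(** Sum of the strong convexity inequalities for the pairs $(x,y)$ and $(y,x)$. *)
Lemma strongly_convex_monotone (R : realType) (n m : nat)
    (F : 'rV[R]_n -> 'rV[R]_m) (i : 'I_m) (mu : R) (x y : 'rV[R]_n) :
  strongly_convex F i mu ->
  mu * dot (y - x) (y - x) <= dot (y - x) (grad F i y - grad F i x).
Proof.
move=> [_ Fcvx]; rewrite [leRHS]dotC; have := Fcvx x y; have := Fcvx y x.
move: (grad F i x) (grad F i y) => gx gy.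
rewrite !sqr_enorm !dotE (dotC x y); lra.
Qed.

(** Serves to make [L] positive before dividing by it. Strong monotonicity and Cauchy-Schwarz are
    compared on the segment from 0 to [d], and $\|d\|^2$ is cancelled. *)
Lemma strongly_convex_modulus_le (R : realType) (n m : nat)
    (F : 'rV[R]_n -> 'rV[R]_m) (i : 'I_m) (mu L : R) (d : 'rV[R]_n) :
  d != 0 -> strongly_convex F i mu -> lipschitz_gradient F i L -> mu <= L.
Proof.
move=> d0 Fcvx Flip; rewrite -(ler_pM2r (dot_gt0 d0)).
have := strongly_convex_monotone 0 d Fcvx; rewrite subr0 => /le_trans; apply.
apply: le_trans (dot_le_enormM _ _) _.
rewrite -sqr_enorm expr2 mulrA mulrC ler_wpM2r ?enorm_ge0 //.
by have := Flip 0 d; rewrite subr0.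
Qed.

(** * Lower bounds for the Barzilai-Borwein parameters and the averaging weights *)

Lemma bb_alpha_ge_min (R : realType) (n : nat) (alpha_min alpha_max : R)
    (s y : 'rV[R]_n) :
  alpha_min <= bb_alpha alpha_min alpha_max s y.
Proof. by rewrite /bb_alpha; do 2?case: ifP => _; rewrite ?le_max lexx. Qed.

(** The curvature condition selects the first branch and makes its quotient at least [mu]; the cap
    [alpha_max] cannot push it below [mu]. *)
Lemma bb_alpha_ge_modulus (R : realType) (n : nat) (alpha_min alpha_max mu : R)
    (s y : 'rV[R]_n) :
  0 < mu -> mu <= alpha_max -> s != 0 -> mu * dot s s <= dot s y ->
  mu <= bb_alpha alpha_min alpha_max s y.
Proof.
move=> mu0 mumax s0 sy; have ss := dot_gt0 s0.
rewrite /bb_alpha (lt_le_trans (mulr_gt0 mu0 ss) sy).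
by rewrite le_max le_min ler_pdivlMr // sy mumax orbT.
Qed.

Lemma avg_q_gt0 (R : realType) (eta : R) (k : nat) :
  0 <= eta -> 0 < avg_q eta k.
Proof.
move=> eta0; elim: k => //= k IHk.
by rewrite ltr_wpDl // mulr_ge0 // ltW.
Qed.

(** * Descent directions, reference values and rejected trial steps along a run *)

Section Run.
Variables (R : realType) (n m : nat) (F : 'rV[R]_n -> 'rV[R]_m).
Variables (sigma gamma alpha_min alpha_max : R) (ls : line_search R).
Variables (x : nat -> 'rV[R]_n) (lam : nat -> 'rV[R]_m) (beta : nat -> R).
Hypotheses (sigma_gt0 : 0 < sigma) (gamma_gt0 : 0 < gamma).
Hypotheses (alpha_min_gt0 : 0 < alpha_min) (ls_valid : valid_line_search ls).

Let step := bbdmo_step F sigma gamma alpha_min alpha_max ls x lam beta.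
Let d := direction F alpha_min alpha_max x lam.

Lemma dot_scaled_grad_direction (k : nat) (i : 'I_m) :
  step k ->
  dot (scaled_grad F alpha_min alpha_max x k i) (d k) <= - dot (d k) (d k).
Proof.
move=> [/(min_norm_weights_dot i) + _ _ _]; rewrite /d /direction.
by move: (scaled_grad _ _ _ _ _) => v wmin; rewrite !dotNr dotNl lerN2 opprK.
Qed.

(** Covers iteration 0 as well, where the gradients are not rescaled; later, the positive factor
    $1/\alpha_i^k$ is cancelled. *)
Lemma dot_grad_direction_le0 (k : nat) (i : 'I_m) :
  step k -> dot (grad F i (x k)) (d k) <= 0.
Proof.
move=> /dot_scaled_grad_direction-/(_ i); have := dot_ge0 (d k).
case: k => [|k] /= dd0; first by lra.
set a := bb_alpha _ _ _ _.
have a0 : 0 < a^-1.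
  by rewrite invr_gt0; apply: lt_le_trans (bb_alpha_ge_min _ _ _ _).
rewrite dotZl => /le_trans le; rewrite -(pmulr_rle0 _ a0); apply: le.
by rewrite oppr_le0.
Qed.

Lemma beta_gt0 (k : nat) : step k -> 0 < beta k.
Proof. by move=> [_ _ [[[j ->] _] _] _]; rewrite exprn_gt0. Qed.

(** Acceptance of step $k$ along a descent direction gives $F_i(x^{k+1})\le C_i^k$, and $C_i^{k+1}$
    is a weighted mean of these two numbers. *)
Lemma avg_C_ge (eta : R) (k : nat) (i : 'I_m) :
  ls = AverageType eta -> (forall j, (j < k)%N -> step j) ->
  F (x k) 0 i <= avg_C F eta x k 0 i.
Proof.
move=> lsE; move: ls_valid; rewrite lsE => /andP[eta0 _].
case: k => [|k] // steps; have stepk := steps k (ltnSn k).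
have := dot_grad_direction_le0 i stepk; have := beta_gt0 stepk.
case: stepk => _ _ [[_ /(_ i) +] _]; rewrite -/(d k) => + xE; rewrite -xE.
(* The case split covers [k = 0], where the Armijo reference coincides with $C^0$. *)
have -> : reference F ls x k = avg_C F eta x k by rewrite lsE; case: (k).
rewrite sufficient_decreaseE => acc beta0 dd0.
have {}acc : F (x k.+1) 0 i <= avg_C F eta x k 0 i.
  have : sigma * beta k * dot (grad F i (x k)) (d k) <= 0.
    by rewrite mulr_ge0_le0 // mulr_ge0 ?ltW.
  by move: acc; lra.
have q_ge0 : 0 <= eta * avg_q eta k by rewrite mulr_ge0 ?ltW ?avg_q_gt0 ?ltW.
have q_gt0 : 0 < eta * avg_q eta k + 1 by rewrite ltr_wpDl.
have -> : avg_C F eta x k.+1 0 i =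
    (eta * avg_q eta k * avg_C F eta x k 0 i + F (x k.+1) 0 i) /
    (eta * avg_q eta k + 1).
  by rewrite /= !mxE; field; rewrite gt_eqF.
by rewrite ler_pdivlMr // mulrDr mulr1 lerD2r mulrC ler_wpM2l.
Qed.

Lemma reference_ge (k : nat) (i : 'I_m) :
  (forall j, (j < k)%N -> step j) -> F (x k) 0 i <= reference F ls x k 0 i.
Proof.
case: k => [|k] // steps; rewrite /reference; case lsE: ls => [|M|eta] //.
  (* The default value of the maximum is [F (x k) 0 i] itself. *)
  by rewrite mxE bigmax_ge_id.
exact: avg_C_ge.
Qed.

(** The index is [k.+1] because the parameter compares two successive iterates; step [k] ensures
    that they differ. *)
Lemma dot_grad_direction_le_modulus (k : nat) (i : 'I_m) (mu : R) :
  strongly_convex F i mu -> mu <= alpha_max -> step k -> step k.+1 ->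
  dot (grad F i (x k.+1)) (d k.+1) <= - (mu * dot (d k.+1) (d k.+1)).
Proof.
move=> Fcvx mumax stepk /dot_scaled_grad_direction-/(_ i) /=.
set a := bb_alpha _ _ _ _; have mua : mu <= a.
  apply: bb_alpha_ge_modulus => //; [by case: Fcvx| |].
    have beta0 := beta_gt0 stepk; case: stepk => _ d0 _ ->.
    by rewrite addrAC subrr add0r scaler_eq0 negb_or d0 gt_eqF.
  exact: strongly_convex_monotone.
have a0 : 0 < a by case: Fcvx => mu0 _; apply: lt_le_trans mua.
rewrite dotZl -(ler_pM2l a0) mulrA mulfV ?gt_eqF // mul1r => /le_trans; apply.
by rewrite mulrN lerN2 ler_wpM2r ?dot_ge0.
Qed.

Lemma rejected_step_ge (k : nat) (i : 'I_m) (L mu b : R) :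
  lipschitz_gradient F i L -> strongly_convex F i mu -> mu <= alpha_max ->
  0 < b -> sigma < 1 -> (forall j, (j <= k.+1)%N -> step j) ->
  sigma * b * dot (grad F i (x k.+1)) (d k.+1) <
    F (x k.+1 + b *: d k.+1) 0 i - reference F ls x k.+1 0 i ->
  2 * (1 - sigma) * mu / L <= b.
Proof.
move=> Flip Fcvx mumax b0 sigma1 steps rejected.
have d0 : d k.+1 != 0 by case: (steps k.+1 (leqnn _)).
have dd0 := dot_gt0 d0; have [mu0 Fgrad] := Fcvx.
have L0 : 0 < L := lt_le_trans mu0 (strongly_convex_modulus_le d0 Fcvx Flip).
have gd := dot_grad_direction_le_modulus Fcvx mumax (steps k (leqnSn _))
  (steps k.+1 (leqnn _)).
have Fref := reference_ge i (fun j (hj : (j < k.+1)%N) => steps j (ltnW hj)).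
have Fdesc : F (x k.+1 + b *: d k.+1) 0 i <= F (x k.+1) 0 i +
    dot (grad F i (x k.+1)) (b *: d k.+1) +
    L / 2 * dot (b *: d k.+1) (b *: d k.+1).
  apply: (@descent_lemma _ _ (fun y => F y 0 i) (grad F i)) => // y z.
  apply: le_trans (Fgrad y z); rewrite lerDl mulr_ge0 ?sqr_ge0 //.
  by rewrite divr_ge0 // ltW.
rewrite dotZr (dotZl b (d _)) (dotZr b (d _) (d _)) in Fdesc.
(* Write $g=\langle\nabla F_i,d\rangle$. Rejection, the reference bound and the descent lemma give
   $-(1-\sigma)bg<\frac{L}{2}b^2\|d\|^2$; then $g\le-\mu\|d\|^2$ is used, multiplied by
   $(1-\sigma)b$. *)
rewrite ler_pdivrMr // -(ler_pM2r (mulr_gt0 b0 dd0)).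
have : 0 <= (1 - sigma) * b by rewrite mulr_ge0 ?subr_ge0 ?ltW.
move=> /ler_wpM2l/(_ _ _ gd); lra.
Qed.

End Run.

(** The lower bound concerns [0 < k], since iteration 0 is a plain steepest descent step without
    Barzilai-Borwein parameters. [hlarge] states how large [alpha_max] is taken to be. *)
Theorem proposition2 (R : realType) (n m : nat)
    (F : 'rV[R]_n -> 'rV[R]_m.+1) (L mu : 'I_m.+1 -> R)
    (sigma gamma alpha_min alpha_max : R) (ls : line_search R)
    (x0 : 'rV[R]_n) (x : nat -> 'rV[R]_n) (lam : nat -> 'rV[R]_m.+1)
    (beta : nat -> R) (k : nat)
    (hF : continuously_differentiable F)
    (hL : forall i, lipschitz_gradient F i (L i))
    (hmu : forall i, strongly_convex F i (mu i))
    (hsigma : 0 < sigma < 1) (hsigma2 : sigma <= 1 / 2)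
    (hgamma : 0 < gamma < 1)
    (hmin : 0 < alpha_min) (hmax : 0 < alpha_max)
    (hlarge : forall i, mu i <= alpha_max)
    (hls : valid_line_search ls)
    (hrun : bbdmo_run F sigma gamma alpha_min alpha_max ls x0 x lam beta k) :
  ((0 < k)%N -> Num.min 1 (beta_min sigma gamma mu L) <= beta k)
  /\ beta k <= 1.
Proof.
case/andP: hsigma => sigma0 sigma1; case/andP: hgamma => gamma0 gamma1.
have [_ steps] := hrun.
have [_ _ [[[j betaE] _] beta_max] _] := steps k (leqnn k).
split; last by rewrite betaE exprn_ile1 // ltW.
case: k betaE beta_max steps {hrun} => // k betaE beta_max steps _.
(* Exponent 0 means stepsize 1, which the minimum with 1 absorbs; otherwise $\gamma^{j}$, with the
   lowered exponent, is the preceding trial. *)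
case: j betaE => [->|j betaE]; first by rewrite expr0 ge_min lexx.
pose b := gamma ^+ j; have b0 : 0 < b by rewrite exprn_gt0.
have [i rejected] : exists i, sigma * b *
    dot (grad F i (x k.+1)) (direction F alpha_min alpha_max x lam k.+1) <
    F (x k.+1 + b *: direction F alpha_min alpha_max x lam k.+1) 0 i
      - reference F ls x k.+1 0 i.
  (* If every component accepted [b], maximality of the stepsize would give $b\le\gamma b$, against
     $\gamma<1$. *)
  apply: contrapT => /forallNP accepted.
  suff : b <= beta k.+1 by rewrite betaE exprS -/b leNgt gtr_pMl ?gamma1 //.
  apply: beta_max; split=> [|i]; first by exists j.
  rewrite sufficient_decreaseE leNgt; apply/negP; exact: accepted.
rewrite ge_min; apply/orP; right; rewrite betaE exprS -/b.
apply: (bigmin_inf i) => //.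
have := rejected_step_ge sigma0 gamma0 hmin hls (hL i) (hmu i) (hlarge i) b0
  sigma1 steps rejected.
by move/(ler_wpM2l (ltW gamma0)); rewrite !mulrA [gamma * 2]mulrC.
Qed.
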